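(* Let $m,n$ be positive integers and let $z=(z_1,\ldots,z_m)\in\mathbb{R}^m$ have pairwise distinct nonzero entries. Let $\phi_z:\mathbb{R}^{m\times n}\to\mathbb{R}^n$, $\phi_z(X)=zX$. Then $\phi_z(\textit{PPerm}(m,n))=\mathcal{P}_z(n,m)$.
   Context: $\textit{PPerm}(m,n)\subseteq\mathbb{R}^{m\times n}$ is the convex hull of all $m\times n$ partial permutation matrices (matrices with entries in $\{0,1\}$ with every row sum and column sum in $\{0,1\}$). $\mathcal{P}_z(n,m)\subseteq\mathbb{R}^n$ is the convex hull of all words of length $n$ with entries in $\{0,z_1,\ldots,z_m\}$ whose nonzero entries are pairwise distinct. *)

(* Defs.v *)
From mathcomp Require Import all_boot all_order all_algebra.
From mathcomp Require Import classical_sets reals convex.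

Set Implicit Arguments.
Unset Strict Implicit.
Unset Printing Implicit Defensive.

Import GRing.Theory.

Local Open Scope classical_set_scope.
Local Open Scope ring_scope.

Definition convex_hull (R : realType) (E : lmodType R) (A : set E) : set E :=
  smallest (@convex_set R E) A.

Definition partial_perm_mx (R : realType) (m n : nat) : set 'M[R]_(m, n) :=
  [set X | [/\ forall i j, X i j \in [:: 0; 1],
               forall i, \sum_(j < n) X i j \in [:: 0; 1]
             & forall j, \sum_(i < m) X i j \in [:: 0; 1]]].

Definition PPerm (R : realType) (m n : nat) : set 'M[R]_(m, n) :=
  convex_hull (@partial_perm_mx R m n).
Arguments PPerm R m n : clear implicits.

Definition partial_words (R : realType) (n m : nat) (z : 'rV[R]_m) :
    set 'rV[R]_n :=
  [set w | (forall j, w 0 j = 0 \/ exists i, w 0 j = z 0 i) /\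
           (forall j k, j != k -> w 0 j != 0 -> w 0 k != 0 ->
              w 0 j != w 0 k)].

Definition Ppoly (R : realType) (n m : nat) (z : 'rV[R]_m) : set 'rV[R]_n :=
  convex_hull (@partial_words R n m z).
Arguments Ppoly {R} n m z.

Definition phi (R : realType) (m n : nat) (z : 'rV[R]_m) (X : 'M[R]_(m, n)) :
    'rV[R]_n := z *m X.
Arguments phi {R m n} z X.

(* Main.v *)
Require Import Defs.
From mathcomp Require Import all_boot all_order all_algebra.
From mathcomp Require Import classical_sets reals convex.

Set Implicit Arguments.
Unset Strict Implicit.
Unset Printing Implicit Defensive.

Import GRing.Theory Num.Theory.

Local Open Scope classical_set_scope.
Local Open Scope ring_scope.

(** A linear map commutes with taking convex hulls, so it suffices to see that
    [X |-> z X] maps the partial permutation matrices onto the words. Column [j]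
    of such an [X] has at most one 1, in row [i] say, and selects the letter
    [z_i], or 0 if the column is zero; rows having at most one 1 means that no
    letter is selected twice. Conversely a word [w] is the image of the matrix
    with entries [[w_j = z_i]]. *)

Lemma convex_hull_convex (R : realType) (E : lmodType R) (A : set E) :
  convex_set (convex_hull A).
Proof.
move=> x y t /set_mem hx /set_mem hy; apply/mem_set => B [cB AB].
by apply/set_mem/cB; apply/mem_set; [exact: hx|exact: hy].
Qed.

Lemma linear_conv (R : realType) (E F : lmodType R) (f : {linear E -> F}) t
    (x y : convex_lmodType E) :
  f (conv t x y) = conv t (f x : convex_lmodType F) (f y).
Proof. by rewrite linearD !linearZ. Qed.

(** Minimality of the hull gives both inclusions: the preimage under [f] of the hull of [f @]
    A[is convex and contains]A[, and the image of the hull of]A[is convex and contains]f @[A]. *)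
Lemma convex_hull_linear_image (R : realType) (E F : lmodType R)
    (f : {linear E -> F}) (A : set E) :
  f @` convex_hull A = convex_hull (f @` A).
Proof.
apply/seteqP; split.
  move=> _ [x hx <-]; apply: hx (f @^-1` convex_hull (f @` A)) _; split.
    move=> a b t /set_mem ha /set_mem hb; apply/mem_set.
    rewrite /preimage /= linear_conv; apply/set_mem.
    by apply: convex_hull_convex; exact/mem_set.
  by move=> a Aa; apply: sub_gen_smallest; exists a.
apply: smallest_sub => [_ _ t /set_mem[a ha <-] /set_mem[b hb <-]|].
  apply/mem_set; exists (conv t (a : convex_lmodType E) b).
    by apply/set_mem/convex_hull_convex; exact/mem_set.
  exact: linear_conv.
by move=> _ [a Aa <-]; exists a => //; exact: sub_gen_smallest.
Qed.

(** Two ones at distinct indices push a sum of nonnegative terms up to at least 2. This trades the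
    row and column sum conditions for uniqueness of the position of a 1. *)
Lemma sum_in01P (R : numDomainType) (I : finType) (F : I -> R) :
    (forall i, F i \in [:: 0; 1]) ->
  \sum_i F i \in [:: 0; 1] <-> (forall i j, F i = 1 -> F j = 1 -> i = j).
Proof.
move=> F01; have F_ge0 i : 0 <= F i.
  by have := F01 i; rewrite !inE => /orP[] /eqP ->.
split=> [sF i j Fi Fj|uF].
  apply/eqP/negPn/negP => neq_ij.
  have le2 : 2 <= \sum_i F i.
    rewrite (bigD1 i) //= (bigD1 j) 1?eq_sym //= Fi Fj addrA lerDl.
    exact: sumr_ge0.
  by move: sF le2; rewrite !inE => /orP[] /eqP ->; rewrite ?lern0 ?lern1.
have F0 i : F i != 1 -> F i = 0.
  by have := F01 i; rewrite !inE => /orP[] /eqP -> //; rewrite eqxx.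
have [/existsP[i /eqP Fi]|/existsPn noF] := boolP [exists i, F i == 1].
  rewrite (bigD1 i) //= big1 ?addr0 ?Fi ?inE ?eqxx ?orbT // => j neq_ji.
  by apply: F0; apply: contraNneq neq_ji => Fj; apply/eqP; exact: uF.
by rewrite big1 ?inE ?eqxx // => i _; exact: F0.
Qed.

Lemma partial_perm_mxP (R : realType) (m n : nat) (X : 'M[R]_(m, n)) :
  partial_perm_mx X <->
  [/\ forall i j, X i j \in [:: 0; 1],
      forall i j k, X i j = 1 -> X i k = 1 -> j = k
    & forall j i k, X i j = 1 -> X k j = 1 -> i = k].
Proof.
split=> -[X01 rowX colX]; split=> // i.
- exact/(sum_in01P (F := fun j => X i j)).
- exact/(sum_in01P (F := fun k => X k i)).
- by apply/sum_in01P => // j k; exact: rowX.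
- by apply/sum_in01P => // j k; exact: colX.
Qed.

(** The equation [X i j = 1] is kept along with the letter, so that a letter occurring in two
    columns can be traced to two ones in one row. *)
Lemma phi_partial_perm_mxE (R : realType) (m n : nat) (z : 'rV[R]_m)
    (X : 'M[R]_(m, n)) (j : 'I_n) :
    partial_perm_mx X ->
  phi z X 0 j = 0 \/ exists2 i, X i j = 1 & phi z X 0 j = z 0 i.
Proof.
move=> /partial_perm_mxP[X01 _ colX]; rewrite mxE.
have X0 i : X i j != 1 -> X i j = 0.
  by have := X01 i j; rewrite !inE => /orP[] /eqP -> //; rewrite eqxx.
have [/existsP[i /eqP Xij]|/existsPn noX] := boolP [exists i, X i j == 1].
  right; exists i => //; rewrite (bigD1 i) //= Xij mulr1 big1 ?addr0 // => k.
  by move=> ki; rewrite X0 ?mulr0 //; apply: contraNneq ki => Xkj; apply/eqP/(colX j).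
by left; rewrite big1 // => i _; rewrite X0 ?mulr0.
Qed.

Lemma phi_partial_perm_mx (R : realType) (m n : nat) (z : 'rV[R]_m)
    (z_distinct : forall i j : 'I_m, i != j -> z 0 i != z 0 j)
    (z_neq0 : forall i : 'I_m, z 0 i != 0) :
  phi z @` @partial_perm_mx R m n = @partial_words R n m z.
Proof.
have z_inj i j : z 0 i = z 0 j -> i = j.
  by move=> zij; apply/eqP; apply: contra_eqT zij; exact: z_distinct.
apply/seteqP; split=> [_ [X pX <-]|w [w_letter w_uniq]].
  split=> [j|j k neq_jk].
    have [->|[i _ ->]] := phi_partial_perm_mxE z j pX; first by left.
    by right; exists i.
  have [->|[i Xij ->]] := phi_partial_perm_mxE z j pX; first by rewrite eqxx.
  have [->|[l Xlk ->]] := phi_partial_perm_mxE z k pX; first by rewrite eqxx.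
  (* If the two letters came from the same row, that row would have ones in columns [j] and [k]. *)
  move=> _ _; apply: z_distinct; apply: contraNneq neq_jk => il.
  have [_ rowX _] := (partial_perm_mxP X).1 pX.
  by apply/eqP/(rowX i) => //; rewrite il.
pose X : 'M[R]_(m, n) := \matrix_(i, j) (w 0 j == z 0 i)%:R.
have X1 i j : X i j = 1 -> w 0 j = z 0 i.
  by rewrite mxE; case: eqP => // _ /eqP; rewrite eq_sym oner_eq0.
exists X.
  apply/partial_perm_mxP; split=> [i j|i j k|j i k].
  - by rewrite mxE; case: (_ == _); rewrite !inE eqxx ?orbT.
  (* Two ones in row [i] would make [w] repeat the letter [z 0 i], which is nonzero and hence
     covered by [w_uniq]. *)
  - move=> /X1 wj /X1 wk; apply/eqP; case: eqVneq => // neq_jk.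
    have := w_uniq j k neq_jk; rewrite wj wk eqxx.
    by move=> /(_ (z_neq0 i) (z_neq0 i)).
  - by move=> /X1 wj /X1; rewrite wj; exact: z_inj.
(* Where [w] vanishes, column [j] of [X] is zero because no letter is 0; where [w] has the letter
   [z 0 i], distinctness of the letters leaves only the term of row [i]. *)
apply/rowP => j; rewrite mxE; have [wj|[i wj]] := w_letter j.
  rewrite wj big1 // => i _.
  by rewrite mxE wj eq_sym (negPf (z_neq0 i)) mulr0.
rewrite (bigD1 i) //= big1 ?addr0 => [|k neq_ki].
  by rewrite mxE wj eqxx mulr1.
by rewrite mxE wj eq_sym (negPf (z_distinct _ _ neq_ki)) mulr0.
Qed.

Theorem theorem5p25 (R : realType) (m n : nat)
    (m_gt0 : (0 < m)%N) (n_gt0 : (0 < n)%N) (z : 'rV[R]_m)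
    (z_distinct : forall i j : 'I_m, i != j -> z 0 i != z 0 j)
    (z_neq0 : forall i : 'I_m, z 0 i != 0) :
  phi z @` PPerm R m n = Ppoly n m z.
Proof.
rewrite /Ppoly -phi_partial_perm_mx //.
(* [phi z] unfolds to [mulmx z], which carries the linear structure. *)
exact: (convex_hull_linear_image (mulmx z)).
Qed.
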